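(* Let $\beta>0$ and let $(\varepsilon_t)_{t\in\mathbb{Z}}$ be a sequence of non-negative i.i.d. random variables such that $E(\ln\varepsilon_t)$ and $\mu_8$ exist (are finite), where $\mu_i=E(\varepsilon_t^i)$, and such that $\beta^4\mu_4<1$. Let $X=(X_t)_{t\in\mathbb{Z}}$ be the strictly stationary solution of $$X_t=\beta X_{t-1}\varepsilon_{t-1}+\varepsilon_t,\qquad t\in\mathbb{Z}\ \text{(a.s.)}.$$ Then $$E(X_tX_{t-1})=\beta^3\mu_1E(X_t^2\varepsilon_t^2)+2\beta^2\mu_2E(X_t\varepsilon_t)+\mu_1E(X_t)+\beta\mu_3$$ and $$E(X_t^2X_{t-1}^2)=\beta^4E_1+2\beta^3E_2+2\beta^3\mu_1E_3+4\beta^2\mu_1E_4+\beta^2E_5+2\beta\mu_1E_6+\beta^2\mu_2E(X_t^2\varepsilon_t^2)+2\beta\mu_1\mu_2E(X_t\varepsilon_t)+\mu_2^2,$$ where $$\begin{aligned} E_1&=E(X_t^2X_{t-1}^2\varepsilon_t^2\varepsilon_{t-1}^2)=\beta^2\mu_2E(X_t^4\varepsilon_t^4)+2\beta\mu_3E(X_t^3\varepsilon_t^3)+\mu_4E(X_t^2\varepsilon_t^2),\\ E_2&=E(X_t^2X_{t-1}\varepsilon_t^3\varepsilon_{t-1})=\beta^2\mu_3E(X_t^3\varepsilon_t^3)+2\beta\mu_4E(X_t^2\varepsilon_t^2)+\mu_5E(X_t\varepsilon_t),\\ E_3&=E(X_tX_{t-1}^2\varepsilon_t\varepsilon_{t-1}^2)=\beta\mu_1E(X_t^3\varepsilon_t^3)+\mu_2E(X_t^2\varepsilon_t^2),\\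 E_4&=E(X_tX_{t-1}\varepsilon_t^2\varepsilon_{t-1})=\beta\mu_2E(X_t^2\varepsilon_t^2)+\mu_3E(X_t\varepsilon_t),\\ E_5&=E(X_t^2\varepsilon_t^4)=\beta^2\mu_4E(X_t^2\varepsilon_t^2)+2\beta\mu_5E(X_t\varepsilon_t)+\mu_6,\\ E_6&=E(X_t\varepsilon_t^3)=\beta\mu_3E(X_t\varepsilon_t)+\mu_4. \end{aligned}$$
   Context: That $E(\ln\varepsilon_t)$ exists means $E(|\ln\varepsilon_t|)<+\infty$ (in particular $\varepsilon_t>0$ a.s.). Under the stated hypotheses the strictly stationary solution exists and is a.s. unique; it is given by the a.s. convergent series $X_t=\varepsilon_t+\sum_{n=1}^{\infty}\beta^n\varepsilon_{t-n}\prod_{j=1}^{n}\varepsilon_{t-j}$. In particular $X_t$ is a measurable function of $\varepsilon_s$, $s\le t$. *)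

(* Defs.v *)
From mathcomp Require Export all_boot all_order all_algebra.
From mathcomp Require Export all_classical all_reals all_analysis.

Set Implicit Arguments.
Unset Strict Implicit.
Unset Printing Implicit Defensive.

Export Order.TTheory GRing.Theory Num.Theory.
Export numFieldNormedType.Exports.

Local Open Scope classical_set_scope.
Local Open Scope ring_scope.

Definition mutually_independent (R : realType) (d : measure_display)
    (T : measurableType d) (P : probability T R)
    (Y : int -> {RV P >-> R}) : Prop :=
  forall (s : seq int) (B : int -> set R),
    uniq s -> (forall t, measurable (B t)) ->
    P (\bigcap_(t in [set` s]) (Y t @^-1` B t)) =
    (\prod_(t <- s) P (Y t @^-1` B t))%E.

Definition identically_distributed (R : realType) (d : measure_display)
    (T : measurableType d) (P : probability T R)
    (Y : int -> {RV P >-> R}) : Prop :=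
  forall (s t : int) (B : set R),
    measurable B -> P (Y s @^-1` B) = P (Y t @^-1` B).

Definition iid (R : realType) (d : measure_display)
    (T : measurableType d) (P : probability T R)
    (Y : int -> {RV P >-> R}) : Prop :=
  mutually_independent Y /\ identically_distributed Y.

(* [n.-tuple _] carries the product sigma-algebra, so this is the invariance
   under time shifts of all finite-dimensional distributions. *)
Definition strictly_stationary (R : realType) (d : measure_display)
    (T : measurableType d) (P : probability T R)
    (Y : int -> {RV P >-> R}) : Prop :=
  forall (n : nat) (ts : 'I_n -> int) (h : int)
    (A : set (n.-tuple R)),
    measurable A ->
    P ((fun w => [tuple Y (ts i) w | i < n]) @^-1` A) =
    P ((fun w => [tuple Y (ts i + h) w | i < n]) @^-1` A).

Definition has_finite_mean (R : realType) (d : measure_display)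
    (T : measurableType d) (P : probability T R) (Y : T -> R) : Prop :=
  P.-integrable [set: T] (EFin \o Y).

(* The real number E(Y); meaningful only together with [has_finite_mean P Y],
   since [fine] sends infinite values to 0. *)
Definition mean (R : realType) (d : measure_display)
    (T : measurableType d) (P : probability T R) (Y : T -> R) : R :=
  fine 'E_P[Y]%E.

Definition has_mean (R : realType) (d : measure_display)
    (T : measurableType d) (P : probability T R) (Y : T -> R) (m : R) : Prop :=
  has_finite_mean P Y /\ 'E_P[Y]%E = m%:E.

(* The logarithm is the extended one, with [lne 0 = -oo]: for a nonnegative Y,
   integrability forces Y > 0 almost surely (the real [ln] has [ln 0 = 0]). *)
Definition has_finite_log_mean (R : realType) (d : measure_display)
    (T : measurableType d) (P : probability T R) (Y : T -> R) : Prop :=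
  P.-integrable [set: T] (fun w => lne (Y w)%:E).

(* X_t = beta X_(t-1) eps_(t-1) + eps_t almost surely, for every t. *)
Definition bilinear_solution (R : realType) (d : measure_display)
    (T : measurableType d) (P : probability T R) (beta : R)
    (eps X : int -> {RV P >-> R}) : Prop :=
  forall t : int,
    {ae P, forall w, X t w = beta * X (t - 1) w * eps (t - 1) w + eps t w}.

(* Main.v *)
Require Import Defs.
From mathcomp Require Import measurable_realfun ring lra zify.

Import HBNNSimple.

Set Implicit Arguments.
Unset Strict Implicit.
Unset Printing Implicit Defensive.

Local Open Scope classical_set_scope.
Local Open Scope ring_scope.

(** Put [Z_t = X_t eps_t], so that [X_t = beta Z_(t-1) + eps_t] and
    [Z_t = eps_t (beta Z_(t-1) + eps_t)].  Iterating the latter from 0 gives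
    nondecreasing polynomials [Z^(n)_t] in [|eps_t|, ..., |eps_(t-n+1)|] with
    [Z_t - Z^(n)_t = X_(t-n) beta^n |eps_t ... eps_(t-n)|].  The fourth moment
    of the product is [mu_4 (beta^4 mu_4)^n] and [X] is stationary, so the
    remainder tends to 0 in probability, and by monotonicity [Z^(n)_t -> Z_t]
    almost surely.  Independence of [Z_(t-1)] from [eps_t, eps_(t+1), ...] thus
    only needs the product rule for monomials in the noise, and passes to the
    limit by monotone convergence; the fourth moments of [Z^(n)_t] stay bounded
    because [beta^4 mu_4 < 1].  Every expectation in the theorem is then that of
    a polynomial in [eps_t, Z_(t-1)] or in [eps_t, eps_(t-1), Z_(t-2)]. *)

(** * Product rule for integrals, extended from indicators to functions *)

Section IndependentProduct.
Context (R : realType) (d : measure_display) (T : measurableType d) (P : probability T R).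

(** Linearity carries the rule from indicators to simple functions, monotone convergence to all
    nonnegative [g]. The integral of [g (Y w)] may be infinite; that of [H] is finite so that it can
    be pulled through the limit. *)
Lemma integral_indep_mul (H : T -> R) (Y : {RV P >-> R}) (g : R -> R) :
  measurable_fun setT H -> (forall w, 0 <= H w) -> (\int[P]_w (H w)%:E \is a fin_num)%E ->
  measurable_fun setT g -> (forall x, 0 <= g x) ->
  (forall B, measurable B ->
    (\int[P]_w (H w * \1_B (Y w))%:E = \int[P]_w (H w)%:E * P (Y @^-1` B))%E) ->
  (\int[P]_w (H w * g (Y w))%:E = \int[P]_w (H w)%:E * \int[P]_w (g (Y w))%:E)%E.
Proof.
move=> mH H0 Hfin mg g0 indep.
have /measurable_EFinP mG := mg.
pose f_ := nnsfun_approx measurableT mG.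
have cvgf (x : R) : (fun n => (f_ n x)%:E) @ \oo --> (g x)%:E.
  by apply: (cvg_nnsfun_approx measurableT mG) => // y _; rewrite lee_fin.
have IH0 : (0 <= \int[P]_w (H w)%:E)%E by apply: integral_ge0 => w _; rewrite lee_fin.
have mfY n : measurable_fun setT (fun w => f_ n (Y w)) by exact: measurableT_comp.
have ndf n m x : (n <= m)%N -> f_ n x <= f_ m x.
  by move=> nm; exact/lefP/nd_nnsfun_approx.
have sE n : (\int[P]_w (H w * f_ n (Y w))%:E =
    \int[P]_w (H w)%:E * \int[P]_w (f_ n (Y w))%:E)%E.
  have mB k : measurable (f_ n @^-1` [set k]) by exact: measurable_funPTI.
  have m1 k : measurable_fun setT (fun w => \1_(f_ n @^-1` [set k]) (Y w) : R).
    by apply: measurableT_comp => //; exact: measurable_indic.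
  have k0 (k : R) (w : T) : (0 <= (k * \1_(f_ n @^-1` [set k]) (Y w))%:E)%E.
    by rewrite nnfun_muleindic_ge0.
  have k0H (k : R) (w : T) : (0 <= (k * (H w * \1_(f_ n @^-1` [set k]) (Y w)))%:E)%E.
    by rewrite mulrCA EFinM; apply: mule_ge0; [rewrite lee_fin|exact: k0].
  (* The simple function is split along its level sets, so that [indep] applies to each
     indicator. *)
  transitivity (\sum_(k \in range (f_ n))
      \int[P]_w (k * (H w * \1_(f_ n @^-1` [set k]) (Y w)))%:E)%E.
    rewrite -ge0_integral_fsum//; last first.
      by move=> k; apply/measurable_EFinP/measurable_funM => //; exact: measurable_funM.
    apply: eq_integral => w _; rewrite fsumEFin//; congr EFin.
    rewrite fimfunE; under [RHS]eq_fsbigr do rewrite mulrCA.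
    by rewrite mulr_fsumr.
  have -> : (\int[P]_w (f_ n (Y w))%:E = \sum_(k \in range (f_ n))
      \int[P]_w (k * \1_(f_ n @^-1` [set k]) (Y w))%:E)%E.
    rewrite -ge0_integral_fsum//; last first.
      by move=> k; apply/measurable_EFinP/measurable_funM.
    by apply: eq_integral => w _; rewrite fsumEFin// -fimfunE.
  rewrite ge0_mule_fsumr; last first.
    by move=> k; apply: integral_ge0 => w _; exact: k0.
  apply: eq_fsbigr => k /set_mem[x _ fxk].
  have kge0 : 0 <= k by rewrite -fxk.
  under eq_integral do rewrite EFinM.
  rewrite ge0_integralZl_EFin//; last 2 first.
  - by move=> w _; rewrite lee_fin mulr_ge0.
  - by apply/measurable_EFinP/measurable_funM.
  have -> : (\int[P]_w (k * \1_(f_ n @^-1` [set k]) (Y w))%:E =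
      k%:E * P (Y @^-1` (f_ n @^-1` [set k])))%E.
    under eq_integral do rewrite EFinM.
    rewrite ge0_integralZl_EFin//; last exact/measurable_EFinP.
    congr (_ * _)%E; rewrite -[in RHS](setIT (Y @^-1` _)) -integral_indic//.
    exact: measurable_funPTI.
  by rewrite indep// muleCA.
transitivity (limn (fun n => \int[P]_w (H w * f_ n (Y w))%:E)%E).
  rewrite -monotone_convergence//.
  - apply: eq_integral => w _; apply/esym/cvg_lim => //.
    under eq_fun do rewrite EFinM.
    by rewrite EFinM; apply: cvgeZl => //; exact: cvgf.
  - by move=> n; exact/measurable_EFinP/measurable_funM.
  - by move=> n w _; rewrite lee_fin mulr_ge0.
  - by move=> w _ n m nm; rewrite lee_fin ler_wpM2l// ndf.
have cvgI : (\int[P]_w (f_ n (Y w))%:E)%E @[n --> \oo] --> (\int[P]_w (g (Y w))%:E)%E.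
  have -> : (\int[P]_w (g (Y w))%:E = \int[P]_w limn (fun n => (f_ n (Y w))%:E))%E.
    by apply: eq_integral => w _; apply/esym/cvg_lim => //; exact: cvgf.
  apply: cvg_monotone_convergence => //.
  - by move=> n; exact/measurable_EFinP.
  - by move=> n w _; rewrite lee_fin.
  - by move=> w _ n m nm; rewrite lee_fin ndf.
apply/cvg_lim => //; under eq_fun do rewrite sE.
exact: cvgeZl.
Qed.
End IndependentProduct.

(** * Calculus of finite means *)

Section HasMean.
Context (R : realType) (d : measure_display) (T : measurableType d) (P : probability T R).
Implicit Types (f g : T -> R) (a b c : R).

Lemma has_mean_measurable f a : has_mean P f a -> measurable_fun setT f.
Proof. by case=> /integrableP[/measurable_EFinP]. Qed.

Lemma has_mean_integral f a : has_mean P f a -> (\int[P]_w (f w)%:E = a%:E)%E.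
Proof. by case=> _; rewrite unlock. Qed.

Lemma has_mean_mean f : has_finite_mean P f -> has_mean P f (mean P f).
Proof.
move=> If; split => //; rewrite /mean fineK// unlock.
exact: integrable_fin_num.
Qed.

Lemma meanE f a : has_mean P f a -> mean P f = a.
Proof. by case=> _; rewrite /mean => ->. Qed.

Lemma ge0_has_mean f a : measurable_fun setT f -> (forall w, 0 <= f w) ->
  (\int[P]_w (f w)%:E = a%:E)%E -> has_mean P f a.
Proof.
move=> mf f0 fa; split; last by rewrite unlock.
apply/integrableP; split; first exact/measurable_EFinP.
under eq_integral do rewrite /= ger0_norm//.
by rewrite fa ltry.
Qed.

Lemma has_mean_cst a : has_mean P (fun=> a) a.
Proof.
split; last by rewrite (expectation_cst P).
exact: finite_measure_integrable_cst.
Qed.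

Lemma has_meanD f g a b : has_mean P f a -> has_mean P g b ->
  has_mean P (fun w => f w + g w) (a + b).
Proof.
move=> fa gb; split; first exact: (integrableD measurableT fa.1 gb.1).
rewrite unlock EFinD -(has_mean_integral fa) -(has_mean_integral gb).
exact: (integralD_EFin measurableT fa.1 gb.1).
Qed.

Lemma has_meanZ f a c : has_mean P f a -> has_mean P (fun w => c * f w) (c * a).
Proof.
move=> fa; split; first exact: (integrableZl measurableT c fa.1).
rewrite unlock EFinM -(has_mean_integral fa) -(integralZl measurableT fa.1).
by apply: eq_integral => w _; rewrite EFinM.
Qed.

Lemma has_mean_sum (I : Type) (s : seq I) (Q : pred I) (F : I -> T -> R) (m : I -> R) :
  (forall i, Q i -> has_mean P (F i) (m i)) ->
  has_mean P (fun w => \sum_(i <- s | Q i) F i w) (\sum_(i <- s | Q i) m i).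
Proof.
move=> Fm; elim: s => [|x s IH].
  rewrite big_nil; under eq_fun do rewrite big_nil; exact: has_mean_cst.
rewrite big_cons; under eq_fun do rewrite big_cons.
by case: ifPn => // Qx; apply: has_meanD => //; exact: Fm.
Qed.

(** Measurability of [g] is assumed because the probability space need not be complete. *)
Lemma ae_has_mean f g a : measurable_fun setT g -> {ae P, forall w, f w = g w} ->
  has_mean P f a -> has_mean P g a.
Proof.
move=> mg fg fa; have mf := has_mean_measurable fa.
have mf' : measurable_fun setT (fun w => (f w)%:E) by exact/measurable_EFinP.
have mg' : measurable_fun setT (fun w => (g w)%:E) by exact/measurable_EFinP.
split; last first.
  rewrite unlock -(has_mean_integral fa); apply: ae_eq_integral => //.
  by apply: filterS fg => w /= ->.
apply/integrableP; split => //; have /integrableP[_] := fa.1.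
apply: le_lt_trans; rewrite le_eqVlt; apply/orP; left; apply/eqP.
apply: ge0_ae_eq_integral => //.
- by apply/measurableT_comp.
- by apply/measurableT_comp.
- by apply: filterS fg => w /= ->.
Qed.

Lemma has_mean_unique f a b : has_mean P f a -> has_mean P f b -> a = b.
Proof. by move=> [_ fa] [_]; rewrite fa => -[]. Qed.

Lemma le_has_mean f g a b : (forall w, f w <= g w) ->
  has_mean P f a -> has_mean P g b -> a <= b.
Proof.
move=> fg fa gb; rewrite -lee_fin -(has_mean_integral fa) -(has_mean_integral gb).
apply: (le_integral measurableT fa.1 gb.1) => w _.
by rewrite lee_fin.
Qed.

(** This is monotone convergence with an almost sure limit; the finite limit [b] of the means yields
    integrability of [g]. *)
Lemma has_mean_monotone_cvg (f : nat -> T -> R) g (a : nat -> R) b :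
  (forall n w, 0 <= f n w) -> (forall n w, f n w <= f n.+1 w) ->
  measurable_fun setT g -> (forall n, has_mean P (f n) (a n)) ->
  {ae P, forall w, f n w @[n --> \oo] --> g w} ->
  a n @[n --> \oo] --> b -> has_mean P g b.
Proof.
move=> f0 fS mg fa fg ab.
have mf n := has_mean_measurable (fa n).
have mf' n : measurable_fun setT (fun w => (f n w)%:E) by exact/measurable_EFinP.
have nd w : nondecreasing_seq (fun n => (f n w)%:E).
  by apply/nondecreasing_seqP => n; rewrite lee_fin.
have lE : ({ae P, forall w, limn (fun n => (f n w)%:E) = (g w)%:E})%E.
  by apply: filterS fg => w fw; apply/cvg_lim => //; apply: cvg_EFin => //; exact: nearW.
have g0 : {ae P, forall w, g w = Num.max (g w) 0}.
  apply: filterS fg => w fw; apply/esym/max_idPl.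
  have := fw => /cvg_lim <- //; apply: limr_ge; first by apply/cvg_ex; exists (g w).
  exact: nearW.
(* On the null set without convergence [g] may be negative; its positive part is nonnegative
   everywhere. *)
suff : has_mean P (fun w => Num.max (g w) 0) b.
  by apply: ae_has_mean => //; apply: filterS g0 => w <-.
have mm : measurable_fun setT (fun w => Num.max (g w) 0).
  by apply: measurable_maxr => //; exact: measurable_cst.
apply: ge0_has_mean => //; first by move=> w; rewrite le_max lexx orbT.
transitivity (\int[P]_w limn (fun n => (f n w)%:E))%E.
  apply: ae_eq_integral => //; first exact/measurable_EFinP.
  - apply: (@emeasurable_fun_cvg _ _ _ _ (fun n w => (f n w)%:E)) => // w _.
    exact: ereal_nondecreasing_is_cvgn.
  - by apply: filterS2 lE g0 => w /= -> <-.
rewrite monotone_convergence//; last by move=> n w _; rewrite lee_fin.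
apply/cvg_lim => //; under eq_fun do rewrite (has_mean_integral (fa _)).
apply: cvg_EFin => //; exact: nearW.
Qed.

End HasMean.

(** * Product rule for functions of independent variables *)

Section Independence.
Context (R : realType) (d : measure_display) (T : measurableType d) (P : probability T R).
Variable (Y : int -> {RV P >-> R}).
Hypothesis indY : mutually_independent Y.

Let mY u (F : R -> R) : measurable_fun setT F -> measurable_fun setT (fun w => F (Y u w)).
Proof. by move=> mF; exact: measurableT_comp. Qed.

(* The induction on [s] turns one indicator at a time into a function. *)
Lemma has_mean_prod_indic (s s' : seq int) (F : int -> R -> R) (m : int -> R) (B : int -> set R) :
  uniq (s ++ s') -> (forall u, measurable_fun setT (F u)) -> (forall u x, 0 <= F u x) ->
  (forall u, u \in s -> has_mean P (fun w => F u (Y u w)) (m u)) ->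
  (forall u, measurable (B u)) ->
  has_mean P (fun w => \prod_(u <- s) F u (Y u w) * \prod_(u <- s') \1_(B u) (Y u w))
    (\prod_(u <- s) m u * \prod_(u <- s') fine (P (Y u @^-1` B u))).
Proof.
move=> + mF F0; elim: s s' B => [|x s IH] s' B us Fm mB.
  rewrite big_nil mul1r; under eq_fun do rewrite big_nil mul1r.
  have mYB u : measurable (Y u @^-1` B u).
    by rewrite -[X in measurable X]setTI; exact: measurable_funP.
  (* With only indicators left, their product is the indicator of the intersection in the definition
     of independence. *)
  have -> : (fun w => \prod_(u <- s') \1_(B u) (Y u w)) =
      \1_(\bigcap_(u in [set` s']) Y u @^-1` B u) :> (T -> R).
    apply/funext => w; rewrite indicE; have [/set_mem wB|wB] := boolP (w \in _).
      by apply: big1_seq => u /= us'; rewrite indicE mem_set//; exact: wB.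
    apply/eqP; rewrite prodf_seq_eq0; apply: contraNT wB => /hasPn/= Bs'.
    apply/mem_set => u /= us'; have := Bs' _ us'.
    by rewrite indicE; have [/set_mem|] := boolP (Y u w \in B u); rewrite ?eqxx.
  have mI : measurable (\bigcap_(u in [set` s']) Y u @^-1` B u).
    by apply: fin_bigcap_measurable => // u _; exact: mYB.
  split; first exact: integrable_indic.
  rewrite expectation_indic// indY// -prodEFin; apply: eq_bigr => u _.
  by rewrite fineK// fin_num_measure.
have perm_us : uniq (s ++ x :: s') by rewrite -cat1s uniq_catCA.
have xs : x \notin s by move: us => /=; rewrite mem_cat negb_or => /andP[/andP[]].
have xs' : x \notin s' by move: us => /=; rewrite mem_cat negb_or => /andP[/andP[]].
have us' : uniq (s ++ s') by move: us => /= /andP[].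
have Fms u : u \in s -> has_mean P (fun w => F u (Y u w)) (m u).
  by move=> us0; apply: Fm; rewrite inE us0 orbT.
have FmH := IH s' B us' Fms mB.
set H := (fun w => _ * _) in FmH.
have H0 w : 0 <= H w.
  by rewrite /H mulr_ge0// prodr_ge0.
have Fmx : has_mean P (fun w => F x (Y x w)) (m x) by apply: Fm; rewrite mem_head.
rewrite big_cons -mulrA mulrC.
under eq_fun do rewrite big_cons -mulrA mulrC.
apply: ge0_has_mean.
- by apply: measurable_funM; [exact: (has_mean_measurable FmH)|exact: mY].
- by move=> w; apply: mulr_ge0; [exact: H0|exact: F0].
rewrite EFinM -(has_mean_integral FmH) -(has_mean_integral Fmx).
apply: integral_indep_mul => //.
- exact: (has_mean_measurable FmH).
- by rewrite (has_mean_integral FmH).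
move=> B0 mB0; rewrite (has_mean_integral FmH).
(* Moving [x] to the indicator list, with [B0] as its set, gives exactly the hypothesis on
   indicators of [integral_indep_mul]. *)
have := IH (x :: s') (fun u => if u == x then B0 else B u) perm_us Fms.
have BE (G : set R -> int -> R) :
    \prod_(j <- s') G (if j == x then B0 else B j) j = \prod_(j <- s') G (B j) j.
  apply: eq_big_seq => j js'; case: eqP => // jx.
  by move: xs'; rewrite -jx js'.
have mB' u : measurable (if u == x then B0 else B u) by case: ifP.
move=> /(_ mB') /has_mean_integral.
rewrite big_cons eqxx (BE (fun D j => fine (P (Y j @^-1` D)))) => Eq.
have -> : (P (Y x @^-1` B0) = (fine (P (Y x @^-1` B0)))%:E)%E.
  by rewrite fineK// fin_num_measure// -[X in measurable X]setTI; exact: measurable_funP.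
rewrite -EFinM -mulrA [X in _ * X]mulrC -Eq; apply: eq_integral => w _.
rewrite big_cons eqxx (BE (fun D j => \1_D (Y j w))); congr EFin.
by rewrite /H -mulrA [X in _ * X = _]mulrC.
Qed.

Lemma has_mean_prod (s : seq int) (F : int -> R -> R) (m : int -> R) :
  uniq s -> (forall u, measurable_fun setT (F u)) -> (forall u x, 0 <= F u x) ->
  (forall u, u \in s -> has_mean P (fun w => F u (Y u w)) (m u)) ->
  has_mean P (fun w => \prod_(u <- s) F u (Y u w)) (\prod_(u <- s) m u).
Proof.
move=> us mF F0 Fm.
have := @has_mean_prod_indic s [::] F m (fun=> setT).
rewrite cats0 big_nil mulr1; under eq_fun do rewrite big_nil mulr1.
by apply.
Qed.

End Independence.

(** * Moments of the noise and of the truncated series *)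

Section Moments.
Context (R : realType) (d : measure_display) (T : measurableType d) (P : probability T R).

Lemma identically_distributed_integral (Y : int -> {RV P >-> R}) (g : R -> R) s t :
  identically_distributed Y -> measurable_fun setT g -> (forall x, 0 <= g x) ->
  (\int[P]_w (g (Y s w))%:E = \int[P]_w (g (Y t w))%:E)%E.
Proof.
move=> idY mg g0; have /measurable_EFinP mG := mg.
have pushE u : (\int[P]_w (g (Y u w))%:E = \int[distribution P (Y u)]_x (g x)%:E)%E.
  rewrite ge0_integral_pushforward//.
  by move=> x _; rewrite lee_fin.
by rewrite !pushE; apply: eq_measure_integral => B mB _; exact: idY.
Qed.

(** The dominating function is [1 + |f|^j]. *)
Lemma finite_mean_pow_le (f : T -> R) i j : (i <= j)%N -> measurable_fun setT f ->
  has_finite_mean P (fun w => `|f w| ^+ j) -> has_finite_mean P (fun w => `|f w| ^+ i).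
Proof.
move=> ij mf /has_mean_mean fj.
have := (has_meanD (has_mean_cst P 1) fj).1; apply: le_integrable => //.
  by apply/measurable_EFinP/measurable_funX; exact: measurableT_comp.
move=> w _; rewrite /= lee_fin [leRHS]ger0_norm ?addr_ge0 ?exprn_ge0//.
rewrite ger0_norm ?exprn_ge0//; have [f1|f1] := leP `|f w| 1.
  by rewrite (@le_trans _ _ 1)// ?exprn_ile1// lerDl exprn_ge0.
by rewrite (le_trans (ler_weXn2l (ltW f1) ij))// lerDr.
Qed.

(** Either [b <= h * a] or [a <= h^-1 * b], and one term on the right suffices in each case. The
    coefficient of [a ^+ 4] can be taken as close to 1 as desired, which preserves the contraction
    [beta^4 mu_4 < 1]. *)
Lemma pow4_split (h a b : R) : 0 < h -> 0 <= a -> 0 <= b ->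
  (a + b) ^+ 4 <= (1 + h) ^+ 4 * a ^+ 4 + (1 + h^-1) ^+ 4 * b ^+ 4.
Proof.
move=> h0 a0 b0; rewrite -!exprMn.
have hi0 : 0 < h^-1 by rewrite invr_gt0.
have [ab|ba] := leP b (h * a).
  apply: (@le_trans _ _ (((1 + h) * a) ^+ 4)).
    by apply: lerXn2r; rewrite ?nnegrE; nra.
  by rewrite lerDl exprn_ge0// mulr_ge0// addr_ge0// ltW.
have ab' : a <= h^-1 * b by rewrite mulrC ler_pdivlMr// mulrC ltW.
apply: (@le_trans _ _ (((1 + h^-1) * b) ^+ 4)).
  by apply: lerXn2r; rewrite ?nnegrE; nra.
by rewrite lerDr exprn_ge0// mulr_ge0// addr_ge0// ltW.
Qed.

Variables (beta : R) (eps : int -> {RV P >-> R}).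
Hypothesis beta_gt0 : 0 < beta.
Hypothesis eps_iid : iid eps.
Hypothesis eps_mu8 : forall t : int, has_finite_mean P (fun w => eps t w ^+ 8).

Definition abs_moment i := mean P (fun w => `|eps 0 w| ^+ i).
Local Notation mu := abs_moment.

Lemma has_mean_abs_pow u i : (i <= 8)%N -> has_mean P (fun w => `|eps u w| ^+ i) (mu i).
Proof.
move=> i8; have fm : has_mean P (fun w => `|eps 0 w| ^+ i) (mu i).
  apply/has_mean_mean/(finite_mean_pow_le i8) => //.
  by under eq_fun do rewrite -normrX ger0_norm ?exprn_even_ge0//.
apply: ge0_has_mean => //; first by apply/measurable_funX; exact: measurableT_comp.
rewrite -(has_mean_integral fm).
apply: (@identically_distributed_integral eps (fun x => `|x| ^+ i) u 0 eps_iid.2) => //.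
by apply/measurable_funX; exact: normr_measurable.
Qed.

(* Absolute values make the recursion monotone everywhere, while [eps] is only
   almost surely nonnegative. *)
Fixpoint partial_series (n : nat) (s : int) (w : T) : R :=
  if n is n'.+1 then `|eps s w| * (beta * partial_series n' (s - 1) w + `|eps s w|) else 0.
Local Notation Z := partial_series.

(* The binomial expansion of [|eps_s|^k (|eps_s| + beta Z)^k]. *)
Fixpoint partial_moment (n k : nat) : R :=
  if n is n'.+1 then
    \sum_(i < k.+1) ('C(k, i)%:R * beta ^+ i) * (mu (k + (k - i)) * partial_moment n' i)
  else 0 ^+ k.
Local Notation M := partial_moment.

Lemma partial_series_ge0 n s w : 0 <= Z n s w.
Proof.
elim: n s => [//|n IH] s /=.
by rewrite mulr_ge0// addr_ge0// mulr_ge0// ltW.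
Qed.

Lemma partial_series_le n s w : Z n s w <= Z n.+1 s w.
Proof.
elim: n s => [|n IH] s; first exact: partial_series_ge0.
by rewrite /= ler_wpM2l// lerD2r ler_pM2l//; exact: IH.
Qed.

(** Unrolling the recursion once moves [s] into the list of noise indices, hence the induction over
    all lists [l] of later times. The new exponent [k + (k - i)] is at most 8 because [k <= 4]. *)
Lemma has_mean_partial_series n s (l : seq int) (a : int -> nat) k :
  uniq l -> (forall u, u \in l -> (s < u) && (a u <= 8)%N) -> (k <= 4)%N ->
  has_mean P (fun w => \prod_(u <- l) `|eps u w| ^+ a u * Z n s w ^+ k)
    (\prod_(u <- l) mu (a u) * M n k).
Proof.
elim: n s l a k => [|n IH] s l a k ul la k4.
  (* At [n = 0] the series and its moment both contribute [0 ^+ k], which is 1 for [k = 0]; the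
     product rule for the noise remains. *)
  under eq_fun do rewrite /= mulrC.
  rewrite mulrC; apply: has_meanZ.
  apply: (has_mean_prod eps_iid.1 (F := fun u x => `|x| ^+ a u)) => //.
  - by move=> u; apply/measurable_funX; exact: normr_measurable.
  - by move=> u /la /andP[_ ?]; exact: has_mean_abs_pow.
have sl : s \notin l by apply/negP => /la; rewrite ltxx.
pose a' i u := if u == s then (k + (k - i))%N else a u.
have prodE (g : int -> nat -> R) i :
    \prod_(u <- s :: l) g u (a' i u) = g s (k + (k - i))%N * \prod_(u <- l) g u (a u).
  rewrite big_cons {1}/a' eqxx; congr (_ * _); apply: eq_big_seq => u ul'.
  by rewrite /a'; case: eqP => // us; move: sl; rewrite -us ul'.
have -> : (fun w => \prod_(u <- l) `|eps u w| ^+ a u * Z n.+1 s w ^+ k) =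
    (fun w => \sum_(i < k.+1) ('C(k, i)%:R * beta ^+ i) *
       (\prod_(u <- s :: l) `|eps u w| ^+ a' i u * Z n (s - 1) w ^+ i)).
  (* The commutation makes [i] the exponent of [beta * Z] in the binomial expansion. *)
  apply/funext => w; rewrite /= exprMn [beta * _ + _]addrC exprDn !mulr_sumr; apply: eq_bigr => i _.
  rewrite (prodE (fun u j => `|eps u w| ^+ j)) exprD exprMn -mulr_natl.
  ring.
rewrite /= mulr_sumr.
have -> : \sum_(i < k.+1) \prod_(u <- l) mu (a u) *
      ('C(k, i)%:R * beta ^+ i * (mu (k + (k - i)) * M n i)) =
    \sum_(i < k.+1) 'C(k, i)%:R * beta ^+ i * (\prod_(u <- s :: l) mu (a' i u) * M n i).
  by apply: eq_bigr => i _; rewrite (prodE (fun u j => mu j)); ring.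
apply: has_mean_sum => i _; apply: has_meanZ; apply: IH.
- by rewrite /= sl.
- move=> u; rewrite inE /a'; case: eqP => [-> _|_ /= /la /andP[su ->]].
    by apply/andP; split; lia.
  by rewrite andbT; lia.
- by have := ltn_ord i; lia.
Qed.

Lemma has_mean_partial_series_pow n s k : (k <= 4)%N ->
  has_mean P (fun w => Z n s w ^+ k) (M n k).
Proof.
move=> k4; have := @has_mean_partial_series n s [::] (fun=> 0) k isT.
rewrite big_nil mul1r; under eq_fun do rewrite big_nil mul1r.
exact.
Qed.

Lemma partial_moment_le n k : (k <= 4)%N -> M n k <= M n.+1 k.
Proof.
move=> k4; apply: (le_has_mean _ (has_mean_partial_series_pow n 0 k4)
  (has_mean_partial_series_pow n.+1 0 k4)) => w.
by apply: lerXn2r; rewrite ?nnegrE ?partial_series_ge0// partial_series_le.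
Qed.

Lemma abs_moment_ge0 i : (i <= 8)%N -> 0 <= mu i.
Proof.
move=> i8; apply: (le_has_mean _ (has_mean_cst P 0) (has_mean_abs_pow 0 i8)) => w.
by rewrite exprn_ge0.
Qed.

(** Apply [pow4_split] to [beta * z + e], multiply by [e ^+ 4] and take means: independence gives
    [mu 4 * M n 4], and [e ^+ 8] gives [mu 8]. *)
Lemma partial_moment4_rec h n : 0 < h ->
  M n.+1 4 <= (1 + h) ^+ 4 * (beta ^+ 4 * mu 4) * M n 4 + (1 + h^-1) ^+ 4 * mu 8.
Proof.
move=> h0.
have eZ : has_mean P (fun w => `|eps 0 w| ^+ 4 * Z n (0 - 1) w ^+ 4) (mu 4 * M n 4).
  have := @has_mean_partial_series n (0 - 1) [:: 0] (fun=> 4%N) 4 isT.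
  rewrite big_seq1; under eq_fun do rewrite big_seq1.
  by apply => // u; rewrite inE => /eqP ->.
have := has_meanD (has_meanZ ((1 + h) ^+ 4 * beta ^+ 4) eZ)
  (has_meanZ ((1 + h^-1) ^+ 4) (has_mean_abs_pow 0 (isT : (8 <= 8)%N))).
have -> : (1 + h) ^+ 4 * beta ^+ 4 * (mu 4 * M n 4) =
  (1 + h) ^+ 4 * (beta ^+ 4 * mu 4) * M n 4 by ring.
apply: le_has_mean (has_mean_partial_series_pow n.+1 0 (isT : (4 <= 4)%N)) => w.
rewrite [Z n.+1 0 w]/= exprMn.
set e := `|eps 0 w|; set z := Z n _ w.
have z0 : 0 <= z by exact: partial_series_ge0.
have e0 : 0 <= e by exact: normr_ge0.
have bz0 : 0 <= beta * z by rewrite mulr_ge0// ltW.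
have := ler_wpM2l (exprn_ge0 4 e0) (pow4_split h0 bz0 e0).
move=> /le_trans; apply; rewrite le_eqVlt; apply/orP; left; apply/eqP; ring.
Qed.

Hypothesis beta_mu4 : beta ^+ 4 * mu 4 < 1.

(** For small [h] the recursion above is affine with slope [q < 1], so its fixed point bounds the
    sequence, which starts at 0. *)
Lemma partial_moment4_bounded : exists K, forall n, M n 4 <= K.
Proof.
set r := beta ^+ 4 * mu 4.
have r1 : r < 1 by [].
have r0 : 0 <= r by apply: mulr_ge0; [rewrite exprn_ge0// ltW|exact: abs_moment_ge0].
(* For [h <= 1], [(1 + h)^4 <= 1 + 15 h] since [4 + 6 + 4 + 1 = 15]; this [h] then gives
   [1 - q >= (1 - r) (1 - 15 r / 16) > 0]. *)
pose h := (1 - r) / 16.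
have h0 : 0 < h by rewrite divr_gt0// subr_gt0.
pose q := (1 + h) ^+ 4 * r.
have q1 : q < 1.
  have h1 : h <= 1 by rewrite /h; lra.
  have hh : (1 + h) ^+ 4 <= 1 + 15 * h.
    have h2 : h * h <= h by rewrite ler_piMr// ltW.
    have h3 := ler_wpM2l (ltW h0) h2.
    have h4 := ler_wpM2l (ltW h0) h3.
    have -> : (1 + h) ^+ 4 = 1 + 4 * h + 6 * (h * h) + 4 * (h * (h * h))
      + h * (h * (h * h)) by ring.
    lra.
  have := ler_wpM2r r0 hh; rewrite -/q => /le_lt_trans; apply.
  have r1' : 0 < 1 - r by rewrite subr_gt0.
  have : 0 < (1 - r) * (1 - 15 / 16 * r) by apply: mulr_gt0 => //; lra.
  rewrite /h; nra.
pose C := (1 + h^-1) ^+ 4 * mu 8.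
have C0 : 0 <= C.
  apply: mulr_ge0; last exact: abs_moment_ge0.
  by rewrite exprn_ge0// addr_ge0// invr_ge0 ltW.
have q0 : 0 <= q by rewrite mulr_ge0// exprn_ge0// addr_ge0// ltW.
have q1' : 0 < 1 - q by rewrite subr_gt0.
exists (C / (1 - q)); elim => [|n IH]; first by rewrite /= expr0n divr_ge0// ltW.
apply: le_trans (partial_moment4_rec n h0) _; rewrite -/r -/q -/C.
apply: (@le_trans _ _ (q * (C / (1 - q)) + C)); first by rewrite lerD2r ler_wpM2l.
by rewrite le_eqVlt; apply/orP; left; apply/eqP; field; rewrite gt_eqF.
Qed.

(** This is to be [E(Z_t^k)], expressed through the noise alone; [cvg_partial_moment] makes it a
    genuine limit for [k <= 4]. *)
Definition stationary_moment k : R := limn (M ^~ k).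
Local Notation m := stationary_moment.

Lemma cvg_partial_moment k : (k <= 4)%N -> M n k @[n --> \oo] --> m k.
Proof.
move=> k4; have [K MK] := partial_moment4_bounded.
apply: nondecreasing_is_cvgn; first by apply/nondecreasing_seqP => n; exact: partial_moment_le.
exists (1 + K) => _ [n _ <-].
(* Lower moments are bounded through [Z^k <= 1 + Z^4]. *)
apply: (@le_trans _ _ (1 + M n 4)); last by rewrite lerD2l.
have := has_meanD (has_mean_cst P 1) (has_mean_partial_series_pow n 0 (isT : (4 <= 4)%N)).
apply: le_has_mean (has_mean_partial_series_pow n 0 k4) => w.
have Z0 := partial_series_ge0 n 0 w.
have [f1|f1] := leP (Z n 0 w) 1.
  by rewrite (@le_trans _ _ 1)// ?exprn_ile1// lerDl exprn_ge0.
by rewrite (le_trans (ler_weXn2l (ltW f1) k4))// lerDr.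
Qed.

(** Monotone convergence passes [has_mean_partial_series] to the limit; [W] will be [X_s eps_s]. *)
Lemma has_mean_limit (W : T -> R) s (l : seq int) (a : int -> nat) k :
  measurable_fun setT W -> {ae P, forall w, Z n s w @[n --> \oo] --> W w} ->
  uniq l -> (forall u, u \in l -> (s < u) && (a u <= 8)%N) -> (k <= 4)%N ->
  has_mean P (fun w => \prod_(u <- l) `|eps u w| ^+ a u * W w ^+ k)
    (\prod_(u <- l) mu (a u) * m k).
Proof.
move=> mW ZW ul la k4.
have p0 w : 0 <= \prod_(u <- l) `|eps u w| ^+ a u.
  by rewrite prodr_ge0// => u _; rewrite exprn_ge0.
apply: (has_mean_monotone_cvg _ _ _
  (fun n => has_mean_partial_series n ul la k4)).
- by move=> n w; rewrite mulr_ge0// exprn_ge0// partial_series_ge0.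
- move=> n w; rewrite ler_wpM2l//.
  by apply: lerXn2r; rewrite ?nnegrE ?partial_series_ge0// partial_series_le.
- apply: measurable_funM; last exact: measurable_funX.
  apply: measurable_prod => u _; apply: measurable_funX; exact: measurableT_comp.
- apply: filterS ZW => w Zw; apply: cvgM; first exact: cvg_cst.
  by apply: (@continuous_cvg _ _ _ _ _ _ (fun x : R => x ^+ k)) => //; exact: exprn_continuous.
- by apply: cvgM; [exact: cvg_cst|exact: cvg_partial_moment].
Qed.

End Moments.

(** Convergence in probability makes the remainder small only along some indices; monotonicity
    upgrades this to convergence of the whole sequence. *)
Lemma nondecreasing_cvg_frequently (R : realType) (u : nat -> R) (l : R) :
  (forall n, u n <= u n.+1) ->
  (forall k N : nat, exists2 n, (N <= n)%N & `|l - u n| < k.+1%:R^-1) ->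
  u n @[n --> \oo] --> l.
Proof.
move=> /nondecreasing_seqP ndu freq.
have small e : 0 < e -> forall N, exists2 n, (N <= n)%N & `|l - u n| < e.
  move=> e0 N; have [k _ kP] := near_infty_natSinv_lt (PosNum e0).
  have [n Nn ln] := freq k N; exists n => //; apply: lt_trans ln _.
  by apply: (kP k) => /=.
have ul n : u n <= l.
  rewrite leNgt; apply/negP => lu.
  (* A term above [l] would keep all later terms at least [u n - l] away from [l]. *)
  have [m nm] := small (u n - l) (ltac:(by rewrite subr_gt0)) n.
  have := ndu _ _ nm; rewrite ltr_distlC => um /andP[_]; lra.
apply/cvgrPdist_lt => e e0; have [n _ ln] := small e e0 0.
exists n => // m /= nm; have := ndu _ _ nm; have := ul m.
move: ln; rewrite !ltr_distlC => /andP[? ?] ? ?; apply/andP; split; lra.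
Qed.

(** * Tightness, the Markov inequality and frequent smallness of products *)

Section Probability.
Context (R : realType) (d : measure_display) (T : measurableType d) (P : probability T R).

Lemma measurable_norm_gt (V : T -> R) (M : R) : measurable_fun setT V ->
  measurable [set w | M < `|V w|].
Proof.
move=> mV; rewrite -[X in measurable X]setTI.
have -> : [set w | M < `|V w|] = (fun w => `|V w|) @^-1` `]M, +oo[%classic.
  by apply/seteqP; split => w /=; rewrite in_itv/= andbT.
have mn : measurable_fun setT (fun w => `|V w|) by exact: measurableT_comp.
exact: mn.
Qed.

Lemma measurable_ge_set (Q : T -> R) (M : R) : measurable_fun setT Q ->
  measurable [set w | M <= Q w].
Proof.
move=> mQ; rewrite -[X in measurable X]setTI.
have -> : [set w | M <= Q w] = Q @^-1` `[M, +oo[%classic.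
  by apply/seteqP; split => w /=; rewrite in_itv/= andbT.
exact: mQ.
Qed.

(** The sets where [|V|] exceeds [k + 1] decrease to the empty set, and [P] is continuous from
    above. *)
Lemma tightness (V : T -> R) (e : R) : measurable_fun setT V -> 0 < e ->
  exists2 M : R, 0 < M & (P [set w | (M < `|V w|)%R] <= e%:E)%E.
Proof.
move=> mV e0; pose U k := [set w | k.+1%:R < `|V w|].
have mU k : measurable (U k) by exact: measurable_norm_gt.
have IU : \bigcap_n U n = set0.
  apply/seteqP; split => // w /= /(_ (Num.truncn `|V w|) Logic.I).
  by rewrite /U /= ltNge (ltW (truncnS_gt _)).
have cvgU : P \o U @ \oo --> 0%E.
  rewrite -(measure0 P) -IU; apply: nonincreasing_cvg_mu => //.
  - by rewrite (le_lt_trans (probability_le1 P (mU _)))// ltry.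
  - by rewrite IU.
  - move=> m n mn; apply/subsetPset => w /=; apply: le_lt_trans.
    by rewrite ler_nat.
have /fine_cvgP[_ /cvgrPdist_le /(_ e e0)[k _ /(_ k (leqnn k))]] := cvgU.
rewrite /= sub0r normrN ger0_norm ?fine_ge0// => Pk.
by exists k.+1%:R => //; rewrite -/(U k) -[X in (X <= _)%E]fineK ?fin_num_measure// lee_fin.
Qed.

Lemma markov_pow4 (Q : T -> R) (a c : R) : measurable_fun setT Q -> 0 < a ->
  has_mean P (fun w => Q w ^+ 4) c -> (P [set w | (a <= Q w)%R] <= (c / a ^+ 4)%:E)%E.
Proof.
move=> mQ a0 Qc; have mA := measurable_ge_set a mQ.
rewrite -[X in (X <= _)%E]fineK ?fin_num_measure// lee_fin.
have PA : has_mean P (\1_[set w | a <= Q w]) (fine (P [set w | a <= Q w])).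
  split; first exact: integrable_indic.
  by rewrite expectation_indic// fineK// fin_num_measure.
rewrite ler_pdivlMr ?exprn_gt0// mulrC.
apply: (le_has_mean _ (has_meanZ (a ^+ 4) PA) Qc) => w.
rewrite indicE; have [/set_mem/= aQ|_] := boolP (w \in _).
  by rewrite mulr1; apply: lerXn2r; rewrite ?nnegrE ?(ltW a0)// (le_trans (ltW a0)).
by rewrite mulr0 exprn_even_ge0.
Qed.

(** The [V n] have common tails, hence are uniformly tight, and [Q n] tends to 0 in fourth mean, so
    the product tends to 0 in probability. Failure for every [n >= N] lies in each single failure
    event and therefore has probability 0. *)
Lemma ae_frequently_small (V Q : nat -> T -> R) (c r del : R) (N : nat) :
  (forall n, measurable_fun setT (V n)) -> (forall n, measurable_fun setT (Q n)) ->
  (forall n w, 0 <= Q n w) ->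
  (forall n M, P [set w | M < `|V n w|] = P [set w | M < `|V 0%N w|]) ->
  (forall n, has_mean P (fun w => Q n w ^+ 4) (c * r ^+ n)) ->
  0 <= r < 1 -> 0 < del ->
  {ae P, forall w, exists2 n, (N <= n)%N & `|V n w * Q n w| < del}.
Proof.
move=> mV mQ Q0 VE Qc /andP[r0 r1] del0.
pose E n := [set w | del <= `|V n w * Q n w|].
have mE n : measurable (E n).
  apply: measurable_ge_set; apply: measurableT_comp => //.
  exact: measurable_funM.
exists (\bigcap_(n in [set n | (N <= n)%N]) E n); split.
- exact: bigcap_measurableType.
- apply/eqP; rewrite eq_le measure_ge0 andbT; apply/lee_addgt0Pr => e e0.
  rewrite add0e; have e20 : 0 < e / 2 by rewrite divr_gt0.
  have [M M0 PM] := tightness (mV 0%N) e20.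
  have dM0 : 0 < del / M by rewrite divr_gt0.
  have : geometric (c / (del / M) ^+ 4) r @ \oo --> 0.
    by apply: cvg_geometric; rewrite ger0_norm.
  move=> /cvgrPdist_le /(_ _ e20)[n0 _ n0P].
  have {n0P} := n0P (maxn n0 N) (leq_maxl _ _); rewrite sub0r normrN /= => n0P.
  set n := maxn n0 N in n0P.
  (* If [|V n| <= M], a product of size at least [del] forces [Q n >= del / M]. Tightness and the
     Markov inequality bound the two events by [e / 2] each. *)
  apply: (@le_trans _ _ (P ([set w | M < `|V n w|] `|` [set w | del / M <= Q n w]))).
    apply: le_measure; rewrite ?inE.
    + exact: bigcap_measurableType.
    + by apply: measurableU; [exact: measurable_norm_gt|exact: measurable_ge_set].
    + move=> w /= /(_ n (leq_maxr _ _)); rewrite /E /= normrM (ger0_norm (Q0 n w)) => dVQ.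
      have [|VM] := ltP M `|V n w|; [by left|right].
      rewrite ler_pdivrMr// mulrC; apply: le_trans dVQ _.
      by rewrite ler_wpM2r.
  apply: (le_trans (measureU2 _ _ _)).
  + exact: measurable_norm_gt.
  + exact: measurable_ge_set.
  have PVn : (P [set w | (M < `|V n w|)%R] <= (e / 2)%:E)%E by rewrite VE.
  rewrite -[leRHS](_ : ((e / 2)%:E + (e / 2)%:E = e%:E)%E); last first.
    by rewrite -EFinD; congr EFin; field.
  apply: leeD; first exact: PVn.
  apply: le_trans (markov_pow4 (mQ n) dM0 (Qc n)) _.
  rewrite lee_fin; apply: le_trans n0P; rewrite mulrAC; exact: ler_norm.
- move=> w /= nw n /= Nn; rewrite /E /= leNgt; apply/negP => small.
  by apply: nw; exists n.
Qed.

Lemma ae_forall_int (Q : int -> T -> Prop) :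
  (forall u, {ae P, forall w, Q u w}) -> {ae P, forall w, forall u, Q u w}.
Proof.
move=> Qae; have pos := ae_foralln (fun n => Qae (Posz n)).
have neg := ae_foralln (fun n => Qae (Negz n)).
by apply: filterS2 pos neg => w Qp Qn [n|n].
Qed.

End Probability.

(** * Almost sure convergence of the truncated series to the solution *)

Section Convergence.
Context (R : realType) (d : measure_display) (T : measurableType d) (P : probability T R).
Variables (beta : R) (eps X : int -> {RV P >-> R}).
Hypothesis beta_gt0 : 0 < beta.
Hypothesis eps_ge0 : forall t : int, {ae P, forall w, 0 <= eps t w}.
Hypothesis eps_iid : iid eps.
Hypothesis eps_mu8 : forall t : int, has_finite_mean P (fun w => eps t w ^+ 8).
Hypothesis beta_mu4 : beta ^+ 4 * abs_moment eps 4 < 1.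
Hypothesis X_stationary : strictly_stationary X.
Hypothesis X_solution : bilinear_solution beta eps X.

(** Stationarity is used for a single time, shifted by [t - s]. *)
Lemma stationary_tail s t (M : R) :
  P [set w | M < `|X s w|] = P [set w | M < `|X t w|].
Proof.
pose A : set (1.-tuple R) := [set x | M < `|tnth x ord0|].
have mA : measurable A.
  by apply: measurable_norm_gt; exact: measurable_tnth.
have := X_stationary (fun _ : 'I_1 => s) (t - s) mA.
have E u : (fun w => [tuple X u w | i < 1]) @^-1` A = [set w | M < `|X u w|].
  by apply/seteqP; split => w; rewrite /A /= tnth_mktuple.
by rewrite !E addrC subrK.
Qed.

Fixpoint past (n : nat) (s : int) : seq int :=
  s :: if n is n'.+1 then past n' (s - 1) else [::].

Lemma past_le n s u : u \in past n s -> u <= s.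
Proof.
elim: n s => [|n IH] s; rewrite /= inE; first by move/eqP->.
by case/orP => [/eqP->//|/IH]; lia.
Qed.

Lemma past_uniq n s : uniq (past n s).
Proof.
elim: n s => [//|n IH] s; rewrite /= IH andbT.
by apply/negP => /past_le; lia.
Qed.

Lemma size_past n s : size (past n s) = n.+1.
Proof. by elim: n s => [//|n IH] s; rewrite /= IH. Qed.

(** The coefficient of [X_(s-n)] left after [n] unrollings: [n] factors [beta] but [n + 1] noise
    factors. *)
Definition past_product n s (w : T) : R := beta ^+ n * \prod_(u <- past n s) `|eps u w|.
Local Notation Q := past_product.

Lemma past_product_ge0 n s w : 0 <= Q n s w.
Proof.
by apply: mulr_ge0; [rewrite exprn_ge0// ltW|rewrite prodr_ge0].
Qed.

Lemma measurable_past_product n s : measurable_fun setT (Q n s).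
Proof.
apply: measurable_funM; first exact: measurable_cst.
by apply: measurable_prod => u _; exact: measurableT_comp.
Qed.

Lemma has_mean_past_product n s :
  has_mean P (fun w => Q n s w ^+ 4)
    (abs_moment eps 4 * (beta ^+ 4 * abs_moment eps 4) ^+ n).
Proof.
have := has_mean_prod eps_iid.1 (F := fun _ x => `|x| ^+ 4) (m := fun=> abs_moment eps 4)
  (past_uniq n s).
have mF (u : int) : measurable_fun setT (fun x : R => `|x| ^+ 4).
  by apply: measurable_funX; exact: normr_measurable.
have F0 (u : int) (x : R) : 0 <= `|x| ^+ 4 by rewrite exprn_ge0.
move=> /(_ mF F0 (fun u _ => has_mean_abs_pow eps_iid eps_mu8 u (isT : (4 <= 8)%N))).
move=> /(has_meanZ ((beta ^+ n) ^+ 4)).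
rewrite big_const_seq count_predT size_past.
rewrite -Monoid.iteropE -[iterop _ _ _ _]/(abs_moment eps 4 ^+ n.+1).
under eq_fun do rewrite prodrXl -exprMn.
by rewrite (exprS (abs_moment _ _)) (exprMn n (beta ^+ 4)) (exprAC beta) mulrCA.
Qed.

(** Each unrolling multiplies the error at time [s - 1] by [beta * eps s w], since the additive
    noise terms cancel. *)
Lemma solution_remainder w (n : nat) s :
  (forall u, X u w = beta * X (u - 1) w * eps (u - 1) w + eps u w) ->
  (forall u, 0 <= eps u w) ->
  X s w * eps s w - partial_series beta eps n s w = X (s - n%:Z) w * Q n s w.
Proof.
move=> Xw ew; elim: n s => [|n IH] s.
  by rewrite /Q /= big_seq1 expr0 mul1r subr0 subr0 ger0_norm.
rewrite /Q /= big_cons ger0_norm// {1}Xw.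
have := IH (s - 1); rewrite /Q.
have -> : s - 1 - n%:Z = s - n.+1%:Z by lia.
set x := X (s - _) w; set z := partial_series _ _ _ _ _; set p := \prod_(_ <- _) _.
move=> E.
transitivity (beta * eps s w * (X (s - 1) w * eps (s - 1) w - z)); first by ring.
by rewrite E exprS; ring.
Qed.

(** The remainder is almost surely small infinitely often at every scale [1 / (k + 1)], and the
    truncations are nondecreasing in [n]. *)
Lemma partial_series_cvg s :
  {ae P, forall w, partial_series beta eps n s w @[n --> \oo] --> X s w * eps s w}.
Proof.
have good := ae_forall_int X_solution.
have pos := ae_forall_int eps_ge0.
have freq : {ae P, forall w, forall k N : nat, exists2 n, (N <= n)%N &
    `|X (s - n%:Z) w * Q n s w| < k.+1%:R^-1}.
  apply: ae_foralln => k; apply: ae_foralln => N.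
  apply: (ae_frequently_small (c := abs_moment eps 4)
    (r := beta ^+ 4 * abs_moment eps 4)
    (V := fun n => X (s - n%:Z)) (Q := fun n => Q n s)) => //.
  - by move=> n; exact: measurable_past_product.
  - by move=> n w; exact: past_product_ge0.
  - by move=> n M; exact: stationary_tail.
  - by move=> n; exact: has_mean_past_product.
  - rewrite beta_mu4 andbT; apply: mulr_ge0; first by rewrite exprn_ge0// ltW.
    exact: abs_moment_ge0.
apply: filterS3 good pos freq => w Xw ew fw.
apply: nondecreasing_cvg_frequently => [n|k N]; first exact: partial_series_le.
have [n Nn small] := fw k N; exists n => //.
by rewrite (solution_remainder _ _ Xw ew).
Qed.

End Convergence.

(** * Means of monomials in the noise and the solution *)

Section Monomials.
Context (R : realType) (d : measure_display) (T : measurableType d) (P : probability T R).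

(** An explicit list of coefficients and exponents reduces a moment computation to two polynomial
    identities, one for the variables and one for their means. *)
Lemma ae_has_mean_lincomb (I : eqType) (G : I -> T -> R) (g : I -> R)
    (l : seq (R * I)) (f : T -> R) (a : R) :
  measurable_fun setT f -> (forall x, x \in l -> has_mean P (G x.2) (g x.2)) ->
  {ae P, forall w, f w = \sum_(x <- l) x.1 * G x.2 w} ->
  a = \sum_(x <- l) x.1 * g x.2 -> has_mean P f a.
Proof.
move=> mf Gg fE ->.
apply: (ae_has_mean (f := fun w => \sum_(x <- l) x.1 * G x.2 w)) => //.
  by apply: filterS fE => w ->.
rewrite big_seq; under eq_fun do rewrite big_seq.
by apply: has_mean_sum => x xl; apply: has_meanZ; exact: Gg.
Qed.

Variables (beta : R) (eps X : int -> {RV P >-> R}).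
Hypothesis beta_gt0 : 0 < beta.
Hypothesis eps_ge0 : forall t : int, {ae P, forall w, 0 <= eps t w}.
Hypothesis eps_iid : iid eps.
Hypothesis eps_mu8 : forall t : int, has_finite_mean P (fun w => eps t w ^+ 8).
Hypothesis beta_mu4 : beta ^+ 4 * abs_moment eps 4 < 1.
Hypothesis X_stationary : strictly_stationary X.
Hypothesis X_solution : bilinear_solution beta eps X.
Local Notation mu := (abs_moment eps).
Local Notation m := (stationary_moment beta eps).

(** This is [has_mean_limit] for [X_s eps_s], with the absolute values removed almost surely. *)
Lemma has_mean_monomial s (l : seq int) (a : int -> nat) k :
  uniq l -> (forall u, u \in l -> (s < u) && (a u <= 8)%N) -> (k <= 4)%N ->
  has_mean P (fun w => \prod_(u <- l) eps u w ^+ a u * (X s w * eps s w) ^+ k)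
    (\prod_(u <- l) mu (a u) * m k).
Proof.
move=> ul la k4.
have mW : measurable_fun setT (fun w => X s w * eps s w) by exact: measurable_funM.
have cv := partial_series_cvg beta_gt0 eps_ge0 eps_iid eps_mu8 beta_mu4
  X_stationary X_solution s.
apply: (ae_has_mean _ _
  (has_mean_limit beta_gt0 eps_iid eps_mu8 beta_mu4 mW cv ul la k4)).
  apply: measurable_funM; last exact: measurable_funX.
  by apply: measurable_prod => u _; exact: measurable_funX.
apply: filterS (ae_forall_int eps_ge0) => w ew; congr (_ * _).
by apply: eq_bigr => u _; rewrite ger0_norm.
Qed.

Lemma has_mean_noise_pow u i : (i <= 8)%N -> has_mean P (fun w => eps u w ^+ i) (mu i).
Proof.
move=> i8; apply: (ae_has_mean _ _ (has_mean_abs_pow eps_iid eps_mu8 u i8)).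
  exact: measurable_funX.
by apply: filterS (eps_ge0 u) => w ew; rewrite ger0_norm.
Qed.

Lemma has_mean_lag0 s k : (k <= 4)%N ->
  has_mean P (fun w => X s w ^+ k * eps s w ^+ k) (m k).
Proof.
move=> k4; have := @has_mean_monomial s [::] (fun=> 0%N) k isT.
rewrite big_nil mul1r; under eq_fun do rewrite big_nil mul1r exprMn.
exact.
Qed.

Lemma has_mean_lag1 t i k : (i <= 8)%N -> (k <= 4)%N ->
  has_mean P (fun w => eps t w ^+ i * (X (t - 1) w * eps (t - 1) w) ^+ k) (mu i * m k).
Proof.
move=> i8 k4; have := @has_mean_monomial (t - 1) [:: t] (fun=> i) k isT.
rewrite big_seq1; under eq_fun do rewrite big_seq1.
by apply => // u; rewrite inE => /eqP ->; apply/andP; split => //; lia.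
Qed.

Lemma has_mean_lag2 t i j k : (i <= 8)%N -> (j <= 8)%N -> (k <= 4)%N ->
  has_mean P (fun w => eps t w ^+ i * eps (t - 1) w ^+ j *
                       (X (t - 2) w * eps (t - 2) w) ^+ k) (mu i * mu j * m k).
Proof.
move=> i8 j8 k4.
have tt1 : (t == t - 1) = false by apply/negbTE; lia.
have t1t : (t - 1 == t) = false by rewrite eq_sym.
have := @has_mean_monomial (t - 2) [:: t; t - 1] (fun u => if u == t then i else j) k.
rewrite big_cons big_seq1 eqxx t1t.
under eq_fun do rewrite big_cons big_seq1 eqxx t1t.
apply => //; first by rewrite /= inE tt1.
move=> u; rewrite !inE => /orP[] /eqP ->; rewrite ?eqxx ?t1t;
  by apply/andP; split => //; lia.
Qed.

Lemma stationary_moment0 : m 0 = 1.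
Proof.
apply: (has_mean_unique _ (has_mean_cst P 1)).
have := has_mean_lag0 0 (isT : (0 <= 4)%N).
by under eq_fun do rewrite !expr0 mulr1.
Qed.

Lemma abs_moment0 : mu 0 = 1.
Proof.
apply: (has_mean_unique _ (has_mean_cst P 1)).
have := has_mean_noise_pow 0 (isT : (0 <= 8)%N).
by under eq_fun do rewrite expr0.
Qed.

End Monomials.

(** * Moment formulas for the stationary solution *)

Theorem mainTheorem4 (R : realType) (d : measure_display)
    (T : measurableType d) (P : probability T R)
    (beta : R) (eps X : int -> {RV P >-> R})
    (beta_gt0 : 0 < beta)
    (eps_ge0 : forall t : int, {ae P, forall w, 0 <= eps t w})
    (eps_iid : iid eps)
    (eps_log : forall t : int, has_finite_log_mean P (eps t))
    (eps_mu8 : forall t : int, has_finite_mean P (fun w => eps t w ^+ 8))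
    (beta_mu4 : beta ^+ 4 * mean P (fun w => eps 0 w ^+ 4) < 1)
    (X_stationary : strictly_stationary X)
    (X_solution : bilinear_solution beta eps X)
    (t : int) :
  let mu (i : nat) := mean P (fun w => eps t w ^+ i) in
  let m (k : nat) := mean P (fun w => X t w ^+ k * eps t w ^+ k) in
  let Y1 := fun w => X t w ^+ 2 * X (t - 1) w ^+ 2
                     * eps t w ^+ 2 * eps (t - 1) w ^+ 2 in
  let Y2 := fun w => X t w ^+ 2 * X (t - 1) w
                     * eps t w ^+ 3 * eps (t - 1) w in
  let Y3 := fun w => X t w * X (t - 1) w ^+ 2
                     * eps t w * eps (t - 1) w ^+ 2 in
  let Y4 := fun w => X t w * X (t - 1) w
                     * eps t w ^+ 2 * eps (t - 1) w in
  let Y5 := fun w => X t w ^+ 2 * eps t w ^+ 4 in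
  let Y6 := fun w => X t w * eps t w ^+ 3 in
  let E1 := mean P Y1 in
  let E2 := mean P Y2 in
  let E3 := mean P Y3 in
  let E4 := mean P Y4 in
  let E5 := mean P Y5 in
  let E6 := mean P Y6 in
  (has_finite_mean P (X t) /\
   forall k : nat, (1 <= k <= 4)%N ->
     has_finite_mean P (fun w => X t w ^+ k * eps t w ^+ k)) /\
  has_mean P (fun w => X t w * X (t - 1) w)
    (beta ^+ 3 * mu 1%N * m 2%N + 2 * beta ^+ 2 * mu 2%N * m 1%N
     + mu 1%N * mean P (X t) + beta * mu 3%N) /\
  has_mean P (fun w => X t w ^+ 2 * X (t - 1) w ^+ 2)
    (beta ^+ 4 * E1 + 2 * beta ^+ 3 * E2 + 2 * beta ^+ 3 * mu 1%N * E3
     + 4 * beta ^+ 2 * mu 1%N * E4 + beta ^+ 2 * E5 + 2 * beta * mu 1%N * E6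
     + beta ^+ 2 * mu 2%N * m 2%N + 2 * beta * mu 1%N * mu 2%N * m 1%N + mu 2%N ^+ 2) /\
  has_mean P Y1 (beta ^+ 2 * mu 2%N * m 4%N + 2 * beta * mu 3%N * m 3%N + mu 4%N * m 2%N) /\
  has_mean P Y2 (beta ^+ 2 * mu 3%N * m 3%N + 2 * beta * mu 4%N * m 2%N + mu 5%N * m 1%N) /\
  has_mean P Y3 (beta * mu 1%N * m 3%N + mu 2%N * m 2%N) /\
  has_mean P Y4 (beta * mu 2%N * m 2%N + mu 3%N * m 1%N) /\
  has_mean P Y5 (beta ^+ 2 * mu 4%N * m 2%N + 2 * beta * mu 5%N * m 1%N + mu 6%N) /\
  has_mean P Y6 (beta * mu 3%N * m 1%N + mu 4%N).
Proof.

move=> mu m Y1 Y2 Y3 Y4 Y5 Y6 E1 E2 E3 E4 E5 E6.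
have mu4E : beta ^+ 4 * abs_moment eps 4 < 1.
  rewrite /abs_moment; under eq_fun do rewrite -normrX ger0_norm ?exprn_even_ge0//.
  exact: beta_mu4.
(* This identifies the moments at time [t] with the absolute moments at time 0. *)
have muE i : (i <= 8)%N -> mu i = abs_moment eps i.
  by move=> i8; apply: meanE; exact: has_mean_noise_pow.
have mP s k := @has_mean_lag0 _ _ _ P beta eps X beta_gt0 eps_ge0 eps_iid eps_mu8 mu4E
  X_stationary X_solution s k.
have mE k : (k <= 4)%N -> m k = stationary_moment beta eps k.
  by move=> k4; apply: meanE; exact: mP.
(* An index lists the exponents of [eps_t] and [Z_(t-1)]; in [G2] below, those of [eps_t],
   [eps_(t-1)] and [Z_(t-2)]. *)
pose G1 (x : nat * nat) w := eps t w ^+ x.1 * (X (t - 1) w * eps (t - 1) w) ^+ x.2.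
pose g1 (x : nat * nat) := mu x.1 * m x.2.
have Gg1 (x : nat * nat) : (x.1 <= 8)%N && (x.2 <= 4)%N -> has_mean P (G1 x) (g1 x).
  by move=> /andP[x1 x2]; rewrite /g1 muE// mE//; exact: has_mean_lag1.
pose G2 (x : nat * nat * nat) w := eps t w ^+ x.1.1 * eps (t - 1) w ^+ x.1.2 *
  (X (t - 2) w * eps (t - 2) w) ^+ x.2.
pose g2 (x : nat * nat * nat) := mu x.1.1 * mu x.1.2 * m x.2.
have Gg2 (x : nat * nat * nat) :
    [&& x.1.1 <= 8, x.1.2 <= 8 & x.2 <= 4]%N -> has_mean P (G2 x) (g2 x).
  by move=> /and3P[x1 x2 x3]; rewrite /g2 !muE// mE//; exact: has_mean_lag2.
have m0 : m 0%N = 1 by rewrite mE// (stationary_moment0 beta_gt0 eps_ge0 eps_iid eps_mu8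
  mu4E X_stationary X_solution).
have mu0 : mu 0%N = 1 by rewrite muE// abs_moment0.
have mX s k : measurable_fun setT (fun w => X s w ^+ k) by exact: measurable_funX.
have me s k : measurable_fun setT (fun w => eps s w ^+ k) by exact: measurable_funX.
have lag1 (l : seq (R * (nat * nat))) f a : measurable_fun setT f ->
    all (fun x => (x.2.1 <= 8)%N && (x.2.2 <= 4)%N) l ->
    (forall w, X t w = beta * X (t - 1) w * eps (t - 1) w + eps t w ->
      f w = \sum_(x <- l) x.1 * G1 x.2 w) ->
    a = \sum_(x <- l) x.1 * g1 x.2 -> has_mean P f a.
  move=> mf /allP lP fE; apply: (ae_has_mean_lincomb (G := G1)) => //.
    by move=> x xl; apply: Gg1; exact: lP.
  by apply: filterS (X_solution t); exact: fE.
have lag2 (l : seq (R * (nat * nat * nat))) f a : measurable_fun setT f ->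
    all (fun x => [&& x.2.1.1 <= 8, x.2.1.2 <= 8 & x.2.2 <= 4]%N) l ->
    (forall w, X t w = beta * X (t - 1) w * eps (t - 1) w + eps t w ->
      X (t - 1) w = beta * (X (t - 2) w * eps (t - 2) w) + eps (t - 1) w ->
      f w = \sum_(x <- l) x.1 * G2 x.2 w) ->
    a = \sum_(x <- l) x.1 * g2 x.2 -> has_mean P f a.
  move=> mf /allP lP fE; apply: (ae_has_mean_lincomb (G := G2)) => //.
    by move=> x xl; apply: Gg2; exact: lP.
  apply: filterS2 (X_solution t) (X_solution (t - 1)) => w Xt Xt1.
  (* The last regrouping turns [t - 1 - 1] into [t - 2]. *)
  by apply: fE => //; rewrite Xt1 -mulrA -addrA.
have EX : has_mean P (X t) (beta * m 1%N + mu 1%N).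
  apply: (lag1 [:: (beta, (0, 1)%N); (1, (1, 0)%N)]) => //.
    by move=> w ->; rewrite !big_cons big_nil /G1 /=; ring.
  by rewrite !big_cons big_nil /g1 /= m0 mu0; ring.
have HY1 : has_mean P Y1
    (beta ^+ 2 * mu 2%N * m 4%N + 2 * beta * mu 3%N * m 3%N + mu 4%N * m 2%N).
  (* The terms of [eps_t^2 Z_(t-1)^2 (beta Z_(t-1) + eps_t)^2]; the lists for the other [Y] arise in
     the same way. *)
  apply: (lag1 [:: (beta ^+ 2, (2, 4)%N); (2 * beta, (3, 3)%N); (1, (4, 2)%N)]) => //.
  - by rewrite /Y1; do 3 (apply: measurable_funM => //).
  - by move=> w Xt; rewrite /Y1 Xt !big_cons big_nil /G1 /=; ring.
  - by rewrite !big_cons big_nil /g1 /=; ring.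
have HY2 : has_mean P Y2
    (beta ^+ 2 * mu 3%N * m 3%N + 2 * beta * mu 4%N * m 2%N + mu 5%N * m 1%N).
  apply: (lag1 [:: (beta ^+ 2, (3, 3)%N); (2 * beta, (4, 2)%N); (1, (5, 1)%N)]) => //.
  - by rewrite /Y2; do 3 (apply: measurable_funM => //).
  - by move=> w Xt; rewrite /Y2 Xt !big_cons big_nil /G1 /=; ring.
  - by rewrite !big_cons big_nil /g1 /=; ring.
have HY3 : has_mean P Y3 (beta * mu 1%N * m 3%N + mu 2%N * m 2%N).
  apply: (lag1 [:: (beta, (1, 3)%N); (1, (2, 2)%N)]) => //.
  - by rewrite /Y3; do 3 (apply: measurable_funM => //).
  - by move=> w Xt; rewrite /Y3 Xt !big_cons big_nil /G1 /=; ring.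
  - by rewrite !big_cons big_nil /g1 /=; ring.
have HY4 : has_mean P Y4 (beta * mu 2%N * m 2%N + mu 3%N * m 1%N).
  apply: (lag1 [:: (beta, (2, 2)%N); (1, (3, 1)%N)]) => //.
  - by rewrite /Y4; do 3 (apply: measurable_funM => //).
  - by move=> w Xt; rewrite /Y4 Xt !big_cons big_nil /G1 /=; ring.
  - by rewrite !big_cons big_nil /g1 /=; ring.
have HY5 : has_mean P Y5
    (beta ^+ 2 * mu 4%N * m 2%N + 2 * beta * mu 5%N * m 1%N + mu 6%N).
  apply: (lag1 [:: (beta ^+ 2, (4, 2)%N); (2 * beta, (5, 1)%N); (1, (6, 0)%N)]) => //.
  - by rewrite /Y5; apply: measurable_funM.
  - by move=> w Xt; rewrite /Y5 Xt !big_cons big_nil /G1 /=; ring.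
  - by rewrite !big_cons big_nil /g1 /= m0; ring.
have HY6 : has_mean P Y6 (beta * mu 3%N * m 1%N + mu 4%N).
  apply: (lag1 [:: (beta, (3, 1)%N); (1, (4, 0)%N)]) => //.
  - by rewrite /Y6; apply: measurable_funM.
  - by move=> w Xt; rewrite /Y6 Xt !big_cons big_nil /G1 /=; ring.
  - by rewrite !big_cons big_nil /g1 /= m0; ring.
split.
  split; first exact: EX.1.
  by move=> k /andP[_ k4]; exact: (mP t k k4).1.
split.
  rewrite (meanE EX).
  (* With [U = X_(t-1) = beta Z_(t-2) + eps_(t-1)], these are the terms of
     [beta eps_(t-1) U^2 + eps_t U]. *)
  apply: (lag2 [:: (beta ^+ 3, (0, 1, 2)%N); (2 * beta ^+ 2, (0, 2, 1)%N); (beta, (0, 3, 0)%N);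
    (beta, (1, 0, 1)%N); (1, (1, 1, 0)%N)]) => //.
  - by apply: measurable_funM.
  - by move=> w -> ->; rewrite !big_cons big_nil /G2 /=; ring.
  - by rewrite !big_cons big_nil /g2 /= m0 mu0; ring.
split; last by [].
rewrite /E1 /E2 /E3 /E4 /E5 /E6 (meanE HY1) (meanE HY2) (meanE HY3) (meanE HY4)
  (meanE HY5) (meanE HY6).
(* With the same [U], the square is [beta^2 eps_(t-1)^2 U^4 + 2 beta eps_t eps_(t-1) U^3 + eps_t^2
   U^2]; the three binomial expansions have 5, 4 and 3 terms. *)
apply: (lag2 [:: (beta ^+ 6, (0, 2, 4)%N); (4 * beta ^+ 5, (0, 3, 3)%N);
    (6 * beta ^+ 4, (0, 4, 2)%N); (4 * beta ^+ 3, (0, 5, 1)%N); (beta ^+ 2, (0, 6, 0)%N);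
    (2 * beta ^+ 4, (1, 1, 3)%N); (6 * beta ^+ 3, (1, 2, 2)%N);
    (6 * beta ^+ 2, (1, 3, 1)%N); (2 * beta, (1, 4, 0)%N);
    (beta ^+ 2, (2, 0, 2)%N); (2 * beta, (2, 1, 1)%N); (1, (2, 2, 0)%N)]) => //.
- by apply: measurable_funM.
- by move=> w -> ->; rewrite !big_cons big_nil /G2 /=; ring.
- by rewrite !big_cons big_nil /g2 /= m0 mu0; ring.
Qed.
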